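(* Let $n \geq 5$, let $\Gamma = GP(n,2)$ and let $D$ be the diameter of $\Gamma$. Then: (i) $\Gamma$ is highly distance-balanced if and only if $n \in \{5,7,10\}$; (ii) $\Gamma$ is $D$-distance-balanced and $(D-1)$-distance-balanced but not $\ell$-distance-balanced for any $1 \leq \ell \leq D-2$ if and only if $n \in \{9,11\}$; (iii) $\Gamma$ is $D$-distance-balanced but not $\ell$-distance-balanced for any $1 \leq \ell \leq D-1$ if and only if $n \notin \{5,7,9,10,11\}$. In particular, if $n > 11$, then $\Gamma$ is $D$-distance-balanced but not $\ell$-distance-balanced for any $1 \leq \ell \leq D-1$.
   Context: The generalized Petersen graph $GP(n,k)$ has vertex set $\{u_i \mid i \in \mathbb{Z}_n\} \cup \{v_i \mid i \in \mathbb{Z}_n\}$ and edges $u_iu_{i+1}$, $v_iv_{i+k}$, $u_iv_i$ for $i \in \mathbb{Z}_n$. For vertices $u,v$, $W_{uv} = \{w \mid d(u,w) < d(v,w)\}$. For a positive integer $\ell$, a connected graph of diameter at least $\ell$ is $\ell$-distance-balanced if $|W_{uv}| = |W_{vu}|$ for all $u,v$ with $d(u,v)=\ell$. A connected graph of diameter $D$ is highly distance-balanced if it is $\ell$-distance-balanced for every $1 \le \ell \le D$.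
   Formalization: In (ii) the range 1 ≤ ℓ ≤ D−2 is required to be nonempty (D ≥ 3); otherwise n = 5 (the Petersen graph, D = 2, both 1- and 2-distance-balanced) would satisfy the left side vacuously although 5 is not in {9,11}. *)

(* Defs.v *)
From mathcomp Require Import all_boot.

Set Implicit Arguments.
Unset Strict Implicit.
Unset Printing Implicit Defensive.

Section Graph.

Variables (T : finType) (e : rel T).

Definition connected_graph : Prop := forall x y : T, connect e x y.

(* Length of a shortest walk from x to y. A shortest walk has fewer than #|T|  *)
(* edges; if there is no walk at all, the value is #|T|.                       *)
Definition gdist (x y : T) : nat :=
  find (fun m => [exists p : m.-tuple T, path e x p && (last x p == y)])
       (iota 0 #|T|).

Definition diameter : nat := \max_(x : T) \max_(y : T) gdist x y.

Definition closer (x y : T) : {set T} := [set w | gdist x w < gdist y w].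

Definition distance_balanced (l : nat) : Prop :=
  [/\ 0 < l, connected_graph, l <= diameter &
      forall x y : T, gdist x y = l -> #|closer x y| = #|closer y x|].

Definition highly_distance_balanced : Prop :=
  connected_graph /\ forall l, 1 <= l <= diameter -> distance_balanced l.

End Graph.

(* inl i is the vertex u_i and inr i is the vertex v_i; Z_n is represented by  *)
(* the residues 'I_n.                                                          *)
Definition GP (n k : nat) : rel ('I_n + 'I_n) := fun x y =>
  match x, y with
  | inl i, inl j => (j == i + 1 %[mod n]) || (i == j + 1 %[mod n])
  | inr i, inr j => (j == i + k %[mod n]) || (i == j + k %[mod n])
  | inl i, inr j | inr i, inl j => i == j
  end.

(* Main.v *)
Require Import Defs.
From mathcomp Require Import all_boot.
From mathcomp Require Import zify.

(** GP(n,2) is a quotient of the infinite graph GP(oo,2), whose distances are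
    given by explicit formulas; a distance in GP(n,2) is the minimum of the two
    distances obtained by going around either way. Two outer (or two inner)
    vertices are exchanged by a reflection, so they are always balanced, and
    only the pairs (u_i, v_j) matter. The diameter is not attained by such a
    pair unless n = 5 or n = 7.

    For the pair (u_0, v_j), the reflection i |-> j - i applied to the inner
    vertices turns |W_{v_j u_0}| - |W_{u_0 v_j}| into a sum over k of
    sgn(d(v_j,u_k) - d(v_0,v_k)) - sgn(d(v_j,u_k) - d(u_0,u_k)). The k-th term
    is nonnegative whenever d(v_0,v_k) <= d(u_0,u_k), that is, unless k is one
    of +-1, +-3. It therefore suffices to beat these four terms by a few
    explicit positive ones, for one well-chosen j at each distance l: j = 0 for
    l = 1 and j = 2l - 3 for l >= 2. This works for all n >= 25, and the
    remaining n are settled by computation. *)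

(** * Recognizing a graph distance by its local behaviour *)

(** Since [d x] grows by at most 1 along an edge, no walk is shorter than [d]; the predecessor
    condition, iterated backwards, yields a walk of length exactly [d x y]. The bound by [#|T|]
    keeps this length in the range that [gdist] searches. *)
Lemma gdist_eq (T : finType) (e : rel T) (d : T -> T -> nat) :
    (forall x, d x x = 0) -> (forall x y, d x y = 0 -> x = y) ->
    (forall x y z, e y z -> d x z <= (d x y).+1) ->
    (forall x y k, d x y = k.+1 -> exists2 z, e z y & d x z = k) ->
    (forall x y, d x y < #|T|) ->
  forall x y, gdist e x y = d x y.
Proof.
move=> dxx d0 dstep dprev dlt x y.
have walk_ge (p : seq T) z : path e z p -> d x (last z p) <= d x z + size p.
  elim: p z => [|w p IHp] z /=; first by rewrite addn0.
  move=> /andP[ezw /IHp le_p]; apply: leq_trans le_p _.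
  by rewrite addnS -addSn leq_add2r dstep.
have walk k z : d x z = k ->
    exists p : k.-tuple T, path e x p && (last x p == z).
  elim: k z => [z /d0 <-|k IHk z /dprev[w ewz /IHk[p /andP[ep /eqP pw]]]].
    by exists [tuple]; rewrite /= eqxx.
  exists [tuple of rcons p z]; rewrite /= rcons_path last_rcons eqxx ep pw.
  by rewrite ewz.
have walk_d : [exists p : (d x y).-tuple T, path e x p && (last x p == y)].
  by apply/existsP; apply: walk.
rewrite /gdist; case: findP => [|i].
  by move/hasPn/(_ (d x y)); rewrite mem_iota add0n dlt walk_d => /(_ isT).
rewrite size_iota => i_lt /(_ 0); rewrite nth_iota // => /existsP[p].
move=> /andP[ep /eqP pl] lt_i; apply/eqP; rewrite eqn_leq.
have := walk_ge _ _ ep; rewrite pl dxx size_tuple /= => ->; rewrite andbT.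
rewrite leqNgt; apply/negP => lt_d; have := lt_i 0 _ lt_d.
by rewrite nth_iota ?dlt // walk_d.
Qed.

Lemma gdist_connected {T : finType} {e : rel T} {x y : T} :
  gdist e x y < #|T| -> connect e x y.
Proof.
move=> lt_d; have: has (fun m =>
   [exists p : m.-tuple T, path e x p && (last x p == y)]) (iota 0 #|T|).
  by rewrite has_find size_iota.
case/hasP => m _ /existsP[p /andP[ep /eqP yp]].
by apply/connectP; exists p.
Qed.

(** * Distances in GP(n,2) *)

(* Distances in GP(oo,2) between u_0 and u_r, u_0 and v_r, v_0 and v_r. *)
Definition luu r := minn r (r.+1 %/ 2 + 2).
Definition luv r := r.+1 %/ 2 + 1.
Definition lvv r := r %/ 2 + 3 * (r %% 2).

Definition wrapd (g : nat -> nat) n r := minn (g r) (g (n - r)).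
(** With truncated subtraction, [(i - j) + (j - i)] is the absolute difference. *)
Definition cyc g n i j := wrapd g n ((i - j) + (j - i)).

Definition pdist {n} (x y : 'I_n + 'I_n) : nat :=
  match x, y with
  | inl i, inl j => cyc luu n i j
  | inr i, inr j => cyc lvv n i j
  | inl i, inr j | inr i, inl j => cyc luv n i j
  end.

(** For residues and [s <= n] at most one wrap past [n] occurs; spelling it out keeps adjacency
    linear, within reach of [lia]. *)
Definition adjacent n s i j :=
  j = i + s \/ j + n = i + s \/ i = j + s \/ i + n = j + s.

Lemma eqn_modD_ord n s (i j : 'I_n) : s <= n ->
  (j == i + s %[mod n]) = (j == i + s :> nat) || (j + n == i + s).
Proof.
move=> sn; have jn := ltn_ord j; have i_n := ltn_ord i.
rewrite (modn_small jn); have [is_n|is_n] := ltnP (i + s) n.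
  by rewrite modn_small //; lia.
by rewrite -(subnK is_n) modnDr modn_small; lia.
Qed.

Lemma adjacentP {n s} {i j : 'I_n} : s <= n ->
  reflect (adjacent n s i j)
    ((j == i + s %[mod n]) || (i == j + s %[mod n])).
Proof.
move=> sn; rewrite !eqn_modD_ord // -orbA.
rewrite /adjacent; apply: (iffP idP); lia.
Qed.

Lemma wrapdC g n r : r <= n -> wrapd g n (n - r) = wrapd g n r.
Proof. by move=> rn; rewrite /wrapd subKn // minnC. Qed.

(** [r] and [t] are arcs from [i] to [j] and to [k], on sides that make them comparable; [t + r = s]
    is the case where the edge jumps over [i]. *)
Lemma cyc_adjacent g n s i j k : s <= n -> i < n -> j < n -> k < n ->
    adjacent n s j k ->
  exists r t, [/\ r <= n, t <= n, cyc g n i j = wrapd g n r,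
    cyc g n i k = wrapd g n t & t = r + s \/ r = t + s \/ t + r = s].
Proof.
move=> sn i_n jn kn jk; set r := (i - j) + (j - i); set t := (i - k) + (k - i).
have rn : r <= n by lia.
have tn : t <= n by lia.
have : (t = r + s \/ r = t + s \/ t + r = s) \/
    (n - t = r + s \/ r = (n - t) + s \/ (n - t) + r = s) \/
    (t = (n - r) + s \/ n - r = t + s \/ t + (n - r) = s) \/
    (n - t = n - r + s \/ n - r = n - t + s \/ (n - t) + (n - r) = s).
  rewrite {}/r {}/t in rn tn *; case: jk => [|[|[|]]] jk;
    have [ij|ij] := leqP i j; have [ik|ik] := leqP i k;
    first [left; lia | right; left; lia | right; right; left; lia
         | right; right; right; lia].
case=> [rt|[rt|[rt|rt]]]; [exists r, t|exists r, (n - t)|exists (n - r), t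
  |exists (n - r), (n - t)]; by rewrite ?wrapdC ?leq_subr.
Qed.

(** [k] is [j] moved by [s] towards [i] along the arc of length [r], which may pass through 0. *)
Lemma cyc_toward n s r i j : i < n -> j < n -> s <= r -> r <= n ->
    r = (i - j) + (j - i) \/ n - r = (i - j) + (j - i) ->
  exists2 k, k < n &
    adjacent n s k j /\ forall g, cyc g n i k = wrapd g n (r - s).
Proof.
move=> i_n jn sr rn rE.
suff [k [kn kj kE]] : exists k, [/\ k < n, adjacent n s k j &
    (i - k) + (k - i) = r - s \/ (i - k) + (k - i) = n - (r - s)].
  exists k => //; split=> // g; rewrite /cyc.
  by case: kE => -> //; rewrite wrapdC //; lia.
case: rE => rE; have [ij|ji] := leqP i j.
- exists (j - s); split; [lia|rewrite /adjacent; lia|lia].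
- exists (j + s); split; [lia|rewrite /adjacent; lia|lia].
- have [?|?] := ltnP (j + s) n.
    exists (j + s); split; [lia|rewrite /adjacent; lia|lia].
  exists (j + s - n); split; [lia|rewrite /adjacent; lia|lia].
have [?|?] := leqP s j.
  exists (j - s); split; [lia|rewrite /adjacent; lia|lia].
exists (j + n - s); split; [lia|rewrite /adjacent; lia|lia].
Qed.

Lemma wrap_step1 n r t : 5 <= n -> r <= n -> t <= n ->
    t = r + 1 \/ r = t + 1 \/ t + r = 1 ->
  wrapd luu n t <= (wrapd luu n r).+1 /\ wrapd luv n t <= (wrapd luv n r).+1.
Proof.
by move=> hn rn tn; rewrite /wrapd /luu /luv => -[|[|]] ?; split; lia.
Qed.

Lemma wrap_step2 n r t : 5 <= n -> r <= n -> t <= n ->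
    t = r + 2 \/ r = t + 2 \/ t + r = 2 ->
  wrapd lvv n t <= (wrapd lvv n r).+1 /\ wrapd luv n t <= (wrapd luv n r).+1.
Proof.
by move=> hn rn tn; rewrite /wrapd /lvv /luv => -[|[|]] ?; split; lia.
Qed.

Lemma wrap_spoke n r : 5 <= n -> r <= n ->
  [/\ wrapd luu n r <= (wrapd luv n r).+1, wrapd luv n r <= (wrapd luu n r).+1,
    wrapd lvv n r <= (wrapd luv n r).+1 & wrapd luv n r <= (wrapd lvv n r).+1].
Proof. by move=> hn rn; rewrite /wrapd /luu /luv /lvv; split; lia. Qed.

Lemma pdist_step n (x y z : 'I_n + 'I_n) : 5 <= n ->
  GP 2 y z -> pdist x z <= (pdist x y).+1.
Proof.
move=> hn; have n1 : 1 <= n by lia. have n2 : 2 <= n by lia.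
case: y => y; case: z => z /=.
- move/(adjacentP n1) => yz.
  case: x => x /=.
    have [r [t [? ? -> -> rt]]] :=
      cyc_adjacent luu n 1 x y z n1 (ltn_ord x) (ltn_ord y) (ltn_ord z) yz.
    by case: (wrap_step1 n r t).
  have [r [t [? ? -> -> rt]]] :=
    cyc_adjacent luv n 1 x y z n1 (ltn_ord x) (ltn_ord y) (ltn_ord z) yz.
  by case: (wrap_step1 n r t).
- move/eqP <-; have xn u : (u : 'I_n) - y + (y - u) <= n.
    by have := ltn_ord u; have := ltn_ord y; lia.
  by case: x => x; case: (wrap_spoke n _ hn (xn x)).
- move/eqP <-; have xn u : (u : 'I_n) - y + (y - u) <= n.
    by have := ltn_ord u; have := ltn_ord y; lia.
  by case: x => x; case: (wrap_spoke n _ hn (xn x)).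
move/(adjacentP n2) => yz.
case: x => x /=.
  have [r [t [? ? -> -> rt]]] :=
    cyc_adjacent luv n 2 x y z n2 (ltn_ord x) (ltn_ord y) (ltn_ord z) yz.
  by case: (wrap_step2 n r t).
have [r [t [? ? -> -> rt]]] :=
  cyc_adjacent lvv n 2 x y z n2 (ltn_ord x) (ltn_ord y) (ltn_ord z) yz.
by case: (wrap_step2 n r t).
Qed.

(** A shortest path can end with a step along its arc or with a spoke; the four clauses are the four
    kinds of pair of endpoints. *)
Lemma wrap_prev n r k : 5 <= n -> r <= n ->
  [/\ luu r <= luu (n - r) -> luu r = k.+1 ->
        1 <= r /\ wrapd luu n (r - 1) = k \/ wrapd luv n r = k,
      luv r <= luv (n - r) -> luv r = k.+1 ->
        1 <= r /\ wrapd luv n (r - 1) = k \/ wrapd lvv n r = k,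
      luv r <= luv (n - r) -> luv r = k.+1 ->
        2 <= r /\ wrapd luv n (r - 2) = k \/ wrapd luu n r = k &
      lvv r <= lvv (n - r) -> lvv r = k.+1 ->
        2 <= r /\ wrapd lvv n (r - 2) = k \/ wrapd luv n r = k].
Proof.
move=> hn rn; rewrite /wrapd /luu /luv /lvv; split; lia.
Qed.

(** As [lvv] is not monotone, the better way round need not be the shorter arc: [r] is chosen by the
    value of [g]. *)
Lemma cyc_argmin g n i j : i < n -> j < n ->
  exists r, [/\ r <= n, r = (i - j) + (j - i) \/ n - r = (i - j) + (j - i),
    g r <= g (n - r), cyc g n i j = g r & forall h, cyc h n i j = wrapd h n r].
Proof.
move=> i_n jn; rewrite /cyc; set r := (i - j) + (j - i).
have rn : r <= n by lia.
have [le_g|/ltnW le_g] := leqP (g r) (g (n - r)).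
  by exists r; split=> //; [left | apply/minn_idPl].
exists (n - r); split; rewrite ?leq_subr ?subKn //; first by right.
  exact/minn_idPr.
by move=> h; rewrite wrapdC.
Qed.

Lemma pdist_prev n (x y : 'I_n + 'I_n) k : 5 <= n ->
  pdist x y = k.+1 -> exists2 z, GP 2 z y & pdist x z = k.
Proof.
move=> hn; have n1 : 1 <= n by lia. have n2 : 2 <= n by lia.
case: x => x; case: y => y /=.
- have [r [rn rE le_r -> cE]] := cyc_argmin luu n x y (ltn_ord x) (ltn_ord y).
  have [+ _ _ _] := wrap_prev n r k hn rn => /(_ le_r) H /H[[r1 <-]|<-].
    have [z zn [zy zE]] :=
      cyc_toward n 1 r x y (ltn_ord x) (ltn_ord y) r1 rn rE.
    by exists (inl (Ordinal zn)); [apply/(adjacentP n1)|rewrite /= zE].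
  by exists (inr y); rewrite /= ?eqxx.
- have [r [rn rE le_r -> cE]] := cyc_argmin luv n x y (ltn_ord x) (ltn_ord y).
  have [_ _ + _] := wrap_prev n r k hn rn => /(_ le_r) H /H[[r2 <-]|<-].
    have [z zn [zy zE]] :=
      cyc_toward n 2 r x y (ltn_ord x) (ltn_ord y) r2 rn rE.
    by exists (inr (Ordinal zn)); [apply/(adjacentP n2)|rewrite /= zE].
  by exists (inl y); rewrite /= ?eqxx.
- have [r [rn rE le_r -> cE]] := cyc_argmin luv n x y (ltn_ord x) (ltn_ord y).
  have [_ + _ _] := wrap_prev n r k hn rn => /(_ le_r) H /H[[r1 <-]|<-].
    have [z zn [zy zE]] :=
      cyc_toward n 1 r x y (ltn_ord x) (ltn_ord y) r1 rn rE.
    by exists (inl (Ordinal zn)); [apply/(adjacentP n1)|rewrite /= zE].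
  by exists (inr y); rewrite /= ?eqxx.
have [r [rn rE le_r -> cE]] := cyc_argmin lvv n x y (ltn_ord x) (ltn_ord y).
have [_ _ _ +] := wrap_prev n r k hn rn => /(_ le_r) H /H[[r2 <-]|<-].
  have [z zn [zy zE]] :=
    cyc_toward n 2 r x y (ltn_ord x) (ltn_ord y) r2 rn rE.
  by exists (inr (Ordinal zn)); [apply/(adjacentP n2)|rewrite /= zE].
by exists (inl y); rewrite /= ?eqxx.
Qed.

Lemma card_GP n : #|{: 'I_n + 'I_n}| = n + n.
Proof. by rewrite card_sum card_ord. Qed.

Lemma pdist_lt n (x y : 'I_n + 'I_n) : 5 <= n -> pdist x y < n + n.
Proof.
move=> hn; case: x => x; case: y => y /=; rewrite /cyc /wrapd /luu /luv /lvv;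
  have := ltn_ord x; have := ltn_ord y; lia.
Qed.

Lemma GP2_gdist n (x y : 'I_n + 'I_n) : 5 <= n ->
  gdist (@GP n 2) x y = pdist x y.
Proof.
move=> hn; apply: gdist_eq => {x y}.
- case=> x; rewrite /= /cyc subnn /wrapd /luu /lvv; lia.
- case=> x [] y /=; rewrite /cyc /wrapd /luu /lvv /luv => xy.
  + congr inl; apply/val_inj => /=.
    by have := ltn_ord x; have := ltn_ord y; lia.
  + by lia.
  + by lia.
  congr inr; apply/val_inj => /=.
  by have := ltn_ord x; have := ltn_ord y; lia.
- by move=> x y z; apply: pdist_step.
- by move=> x y k; apply: pdist_prev.
by move=> x y; rewrite card_GP pdist_lt.
Qed.

Lemma GP2_connected n : 5 <= n -> connected_graph (@GP n 2).
Proof.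
move=> hn x y; apply: gdist_connected.
by rewrite GP2_gdist // card_GP pdist_lt.
Qed.

(** * Reflections and the sizes of the sets W *)

Fact mirror_subproof n c (k : 'I_n) : (c + n - k) %% n < n.
Proof. by rewrite ltn_mod (leq_ltn_trans _ (ltn_ord k)). Qed.

Definition mirror {n} c (k : 'I_n) := Ordinal (mirror_subproof n c k).

Lemma cyc_mirror g n (i j k : 'I_n) :
  cyc g n i (mirror (i + j) k) = cyc g n j k.
Proof.
have := ltn_ord i; have := ltn_ord j; have := ltn_ord k => kn jn i_n.
rewrite /cyc /=; set v := _ %% n.
have v_lt : v < n by rewrite ltn_mod; lia.
have vE : v + k = i + j + n \/ v + k = i + j \/ v + n + k = i + j.
  have := divn_eq (i + j + n - k) n; rewrite -/v.
  set q := _ %/ n => qE.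
  have : q = 0 \/ q = 1 \/ q = 2 by nia.
  by case=> [|[|]] q_eq; rewrite q_eq in qE; lia.
have [->|->] : (i - v) + (v - i) = (j - k) + (k - j) \/
   (i - v) + (v - i) = n - ((j - k) + (k - j)) by lia.
  by [].
by rewrite wrapdC //; lia.
Qed.

Lemma cyc_mirrorC g n (i j k : 'I_n) :
  cyc g n j (mirror (i + j) k) = cyc g n i k.
Proof. by rewrite addnC cyc_mirror. Qed.

Lemma mirror_inj n c : injective (@mirror n c).
Proof.
move=> i j /(congr1 val) /= /eqP eq_ij; apply/val_inj => /=.
have := ltn_ord i; have := ltn_ord j => jn i_n.
(* Adding [i + j] on both sides clears the truncated subtractions. *)
have : c + n - i + (i + j) == c + n - j + (i + j) %[mod n].
  by rewrite eqn_modDr.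
rewrite (_ : _ + (i + j) = c + n + j); last lia.
rewrite (_ : c + n - j + (i + j) = c + n + i); last lia.
by rewrite eqn_modDl !modn_small // => /eqP.
Qed.

Lemma card_closer n (x y : 'I_n + 'I_n) : 5 <= n ->
  #|closer (@GP n 2) x y| =
    \sum_(i < n) (pdist x (inl i) < pdist y (inl i)) +
    \sum_(i < n) (pdist x (inr i) < pdist y (inr i)).
Proof.
move=> hn; rewrite -sum1_card big_mkcond /= big_sumType /=.
by congr (_ + _); apply: eq_bigr => i _; rewrite inE !GP2_gdist //; case: ltnP.
Qed.

Lemma closer_uu n (i j : 'I_n) : 5 <= n ->
  #|closer (@GP n 2) (inl i) (inl j)| = #|closer (@GP n 2) (inl j) (inl i)|.
Proof.
move=> hn; rewrite !card_closer //; congr (_ + _);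
  rewrite (reindex_inj (@mirror_inj n (i + j))) /=; apply: eq_bigr => k _;
  by rewrite cyc_mirror cyc_mirrorC.
Qed.

Lemma closer_vv n (i j : 'I_n) : 5 <= n ->
  #|closer (@GP n 2) (inr i) (inr j)| = #|closer (@GP n 2) (inr j) (inr i)|.
Proof.
move=> hn; rewrite !card_closer //; congr (_ + _);
  rewrite (reindex_inj (@mirror_inj n (i + j))) /=; apply: eq_bigr => k _;
  by rewrite cyc_mirror cyc_mirrorC.
Qed.

Lemma sumn_iota (f : nat -> nat) n :
  sumn [seq f k | k <- iota 0 n] = \sum_(k < n) f k.
Proof.
by rewrite sumnE big_map -[in iota 0 n](subn0 n) -/(index_iota 0 n) big_mkord.
Qed.

(* The v_k contribute through their mirror images under k |-> i + j - k, which
   is why the inner distance is [cyc lvv n i k] and not [cyc lvv n j k]. *)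
Definition uterm n i j k :=
  (cyc luu n i k < cyc luv n j k) + (cyc luv n j k < cyc lvv n i k).
Definition vterm n i j k :=
  (cyc luv n j k < cyc luu n i k) + (cyc lvv n i k < cyc luv n j k).

Lemma closer_uv n (i j : 'I_n) : 5 <= n ->
  #|closer (@GP n 2) (inl i) (inr j)| =
    sumn [seq uterm n i j k | k <- iota 0 n].
Proof.
move=> hn; rewrite card_closer //= sumn_iota.
rewrite [X in _ + X](reindex_inj (@mirror_inj n (i + j))) /=.
rewrite -big_split; apply: eq_bigr => k _.
by rewrite cyc_mirror cyc_mirrorC.
Qed.

Lemma closer_vu n (i j : 'I_n) : 5 <= n ->
  #|closer (@GP n 2) (inr j) (inl i)| =
    sumn [seq vterm n i j k | k <- iota 0 n].
Proof.
move=> hn; rewrite card_closer //= sumn_iota.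
rewrite [X in _ + X](reindex_inj (@mirror_inj n (i + j))) /=.
rewrite -big_split; apply: eq_bigr => k _.
by rewrite cyc_mirror cyc_mirrorC.
Qed.

Definition usum n i j := sumn [seq uterm n i j k | k <- iota 0 n].
Definition vsum n i j := sumn [seq vterm n i j k | k <- iota 0 n].

Lemma GP2_balancedP n l : 5 <= n ->
  distance_balanced (@GP n 2) l <->
  [/\ 0 < l, l <= diameter (@GP n 2) & forall i j : 'I_n,
     cyc luv n i j = l -> usum n i j = vsum n i j].
Proof.
move=> hn; split=> [[l0 _ lD bal]|[l0 lD bal]]; split=> //.
- move=> i j ij; have := bal (inl i) (inr j).
  by rewrite GP2_gdist // closer_uv // closer_vu // => /(_ ij).
- exact: GP2_connected.
case=> i [] j; rewrite GP2_gdist //= => ij.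
- exact: closer_uu.
- by rewrite closer_uv // closer_vu // -/(usum n i j) bal.
- rewrite closer_uv // closer_vu // -/(usum n j i) bal //.
  by rewrite -ij /cyc addnC.
exact: closer_vv.
Qed.

(** * The diameter *)

Lemma GP2_dist_le_diameter n (x y : 'I_n + 'I_n) : 5 <= n ->
  pdist x y <= diameter (@GP n 2).
Proof.
move=> hn; rewrite -GP2_gdist //.
by apply: leq_trans (leq_bigmax x); apply: (leq_bigmax y).
Qed.

(** For [n >= 8] antipodal outer vertices attain the maximum. For [n = 6] these are only at distance
    3, and the inner pair v_0, v_3 attains it. For [n = 5] and [n = 7] the true diameter is one less
    than the formula. *)
Lemma GP2_diameter n : n = 6 \/ 8 <= n ->
  diameter (@GP n 2) = (n %/ 2).+1 %/ 2 + 2.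
Proof.
move=> hn; have n5 : 5 <= n by lia.
apply/eqP; rewrite eqn_leq; apply/andP; split.
  apply/bigmax_leqP => x _; apply/bigmax_leqP => y _; rewrite GP2_gdist //.
  have le_D r : r <= n -> [/\ wrapd luu n r <= (n %/ 2).+1 %/ 2 + 2,
      wrapd luv n r <= (n %/ 2).+1 %/ 2 + 2 &
      wrapd lvv n r <= (n %/ 2).+1 %/ 2 + 2].
    move=> rn; rewrite /wrapd /luu /luv /lvv; case: hn => hn.
      by split; rewrite hn in rn *; lia.
    by split; lia.
  have xy (i j : 'I_n) : (i - j) + (j - i) <= n.
    by have := ltn_ord i; have := ltn_ord j; lia.
  by case: x => x; case: y => y; have [] := le_D _ (xy x y).
have n0 : 0 < n by lia.
have nh : n %/ 2 < n by lia.
case: hn => hn.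
  apply: leq_trans (GP2_dist_le_diameter n (inr (Ordinal n0))
    (inr (Ordinal nh)) n5).
  by rewrite /= hn.
apply: leq_trans (GP2_dist_le_diameter n (inl (Ordinal n0))
  (inl (Ordinal nh)) n5).
by rewrite /= /cyc /wrapd /luu; lia.
Qed.

(** * Strict inequality of the two sums for large n *)

Lemma uterm_le_vterm n j k : 8 <= n -> k < n ->
  k \notin [:: 1; 3; n - 3; n - 1] -> uterm n 0 j k <= vterm n 0 j k.
Proof.
move=> hn kn; rewrite !inE => kK.
have: cyc lvv n 0 k <= cyc luu n 0 k by rewrite /cyc /wrapd /lvv /luu; lia.
by rewrite /uterm /vterm; lia.
Qed.

Lemma sumn_iota_lt (f g : nat -> nat) n K : uniq K -> all (gtn n) K ->
    (forall k, k < n -> k \notin K -> f k <= g k) ->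
    sumn [seq f k | k <- K] < sumn [seq g k | k <- K] ->
  sumn [seq f k | k <- iota 0 n] < sumn [seq g k | k <- iota 0 n].
Proof.
move=> uK /allP ltK le_fg; rewrite !sumnE !big_map => lt_fg.
have KE : perm_eq K [seq k <- iota 0 n | k \in K].
  apply: uniq_perm => // [|k]; first by rewrite filter_uniq // iota_uniq.
  by rewrite mem_filter mem_iota add0n; case: (boolP (k \in K)) => // /ltK.
have splitK h : \sum_(k <- iota 0 n) h k =
    \sum_(k <- K) h k + \sum_(k <- iota 0 n | k \notin K) h k.
  by rewrite (bigID [in K]) /= (perm_big _ KE) big_filter.
rewrite !splitK -addSn leq_add // big_seq_cond [leqRHS]big_seq_cond.
by apply: leq_sum => k; rewrite mem_iota add0n => /andP[kn kK]; apply: le_fg.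
Qed.

Lemma usum_lt_vsum n j K (K' := [:: 1, 3, n - 3, n - 1 & K]) : 8 <= n ->
    uniq K' -> all (gtn n) K' ->
    sumn [seq uterm n 0 j k | k <- K'] < sumn [seq vterm n 0 j k | k <- K'] ->
  usum n 0 j < vsum n 0 j.
Proof.
move=> hn uK ltK; apply: sumn_iota_lt => // k kn kK.
apply: uterm_le_vterm => //; apply: contra kK; rewrite !inE.
by case/or4P=> ->; rewrite ?orbT.
Qed.

(** The terms computed in GP(oo,2), with [kd] standing for (|k|, |j - k|): they no longer depend on
    [n]. *)
Definition uloc (kd : nat * nat) : nat :=
  (luu kd.1 < luv kd.2) + (luv kd.2 < lvv kd.1).
Definition vloc (kd : nat * nat) : nat :=
  (luv kd.2 < luu kd.1) + (lvv kd.1 < luv kd.2).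

(** The short way round wins. The bound for [lvv] is stricter because odd arcs are costly: for
    [n = 25], [lvv 11 = 8] exceeds [lvv 14 = 7]. *)
Lemma wrap_near n r : 25 <= n -> r <= 12 ->
  [/\ wrapd luu n r = luu r, wrapd luv n r = luv r
    & r <= 10 -> wrapd lvv n r = lvv r].
Proof. by move=> hn r12; rewrite /wrapd /luu /luv /lvv; split; lia. Qed.

Lemma term_near n j k : 25 <= n -> j <= 9 -> k <= 10 ->
  uterm n 0 j k = uloc (k, (j - k) + (k - j)) /\
  vterm n 0 j k = vloc (k, (j - k) + (k - j)).
Proof.
move=> hn j9 k10; have k12 : k <= 12 by lia.
have d12 : (j - k) + (k - j) <= 12 by lia.
have [uE _ /(_ k10) vE] := wrap_near n k hn k12.
have [_ aE _] := wrap_near n _ hn d12.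
by rewrite /uterm /vterm /uloc /vloc /cyc /= sub0n add0n subn0 uE aE vE.
Qed.

Lemma term_near_opp n j k : 25 <= n -> j <= 9 -> 0 < k <= 3 ->
  uterm n 0 j (n - k) = uloc (k, j + k) /\
  vterm n 0 j (n - k) = vloc (k, j + k).
Proof.
move=> hn j9 /andP[k0 k3]; have k12 : k <= 12 by lia.
have d12 : j + k <= 12 by lia.
have k10 : k <= 10 by lia.
have [uE _ /(_ k10) vE] := wrap_near n k hn k12.
have [_ aE _] := wrap_near n _ hn d12.
have kn : k <= n by lia.
have jE : (j - (n - k)) + (n - k - j) = n - (j + k) by lia.
rewrite /uterm /vterm /uloc /vloc /cyc /= sub0n add0n subn0 jE !wrapdC //.
  by rewrite uE aE vE.
lia.
Qed.

(** The first four entries of [L] belong to the indices 1, 3, -3, -1. For numerals [j] and [K] the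
    last premise is closed, so one computation serves all [n >= 25]. *)
Lemma usum_lt_vsum_near n j K (L := [:: (1, (j - 1) + (1 - j));
    (3, (j - 3) + (3 - j)); (3, j + 3); (1, j + 1)]
    ++ [seq (k, (j - k) + (k - j)) | k <- K]) :
    25 <= n -> j <= 9 -> uniq [:: 1, 3 & K] -> all (geq 10) K ->
    sumn [seq uloc kd | kd <- L] < sumn [seq vloc kd | kd <- L] ->
  usum n 0 j < vsum n 0 j.
Proof.
move=> hn j9; rewrite !cons_uniq inE => /and3P[/norP[_ K1] K3 uK].
move=> /allP leK lt_uv.
have big k : 10 < k -> k \notin K.
  by move=> k10; apply: contraL k10 => /leK /=; lia.
apply: (usum_lt_vsum n j K).
- lia.
- by rewrite !cons_uniq !inE uK !negb_or K1 K3 !big; lia.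
- have n13 : [&& 1 < n, 3 < n, n - 3 < n & n - 1 < n] by lia.
  case/and4P: n13 => n1 n2 n3 n4; rewrite /= n1 n2 n3 n4 /=.
  by apply/allP => k /leK /=; lia.
have [u1 v1] := term_near n j 1 hn j9 isT.
have [u3 v3] := term_near n j 3 hn j9 isT.
have [u1' v1'] := term_near_opp n j 1 hn j9 isT.
have [u3' v3'] := term_near_opp n j 3 hn j9 isT.
move: lt_uv; rewrite /L /= u1 v1 u3 v3 u1' v1' u3' v3' -!map_comp.
have uK' : {in K, uterm n 0 j =1 uloc \o (fun k => (k, j - k + (k - j)))}.
  by move=> k /leK k10; case: (term_near n j k hn j9 k10).
have vK' : {in K, vterm n 0 j =1 vloc \o (fun k => (k, j - k + (k - j)))}.
  by move=> k /leK k10; case: (term_near n j k hn j9 k10).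
by move/eq_in_map: uK' => ->; move/eq_in_map: vK' => ->.
Qed.

Lemma usum_lt_vsum_le9 n j : 25 <= n -> j \in [:: 0; 1; 3; 7; 9] ->
  usum n 0 j < vsum n 0 j.
Proof.
move=> hn; rewrite !inE => /or4P[|||/orP[]] /eqP->.
(* Each list consists of even [k] for which [luv] of |j - k| lies between [lvv k] and [luu k], the
   mechanism of [uterm_lt_vterm] below. *)
- exact: (usum_lt_vsum_near n 0 [:: 4; 6; 8; 10]).
- exact: (usum_lt_vsum_near n 1 [:: 2; 4; 6; 8]).
- exact: (usum_lt_vsum_near n 3 [:: 2; 4; 6; 8; 10]).
- exact: (usum_lt_vsum_near n 7 [:: 4]).
exact: (usum_lt_vsum_near n 9 [:: 4; 6]).
Qed.

(** Neither inequality counted by [uterm] holds, and the [luv] value cannot equal both ends of a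
    nontrivial interval. *)
Lemma uterm_lt_vterm n j k :
    cyc lvv n 0 k < cyc luu n 0 k ->
    cyc lvv n 0 k <= cyc luv n j k <= cyc luu n 0 k ->
  uterm n 0 j k < vterm n 0 j k.
Proof.
rewrite /uterm /vterm; move: (cyc luu _ _ _) (cyc luv _ _ _) (cyc lvv _ _ _).
by move=> u a v; lia.
Qed.

(** Both terms equal 1. *)
Lemma uterm_le_vterm_far n j k :
    cyc luu n 0 k < cyc luv n j k -> cyc lvv n 0 k < cyc luv n j k ->
  uterm n 0 j k <= vterm n 0 j k.
Proof.
rewrite /uterm /vterm; move: (cyc luu _ _ _) (cyc luv _ _ _) (cyc lvv _ _ _).
by move=> u a v; lia.
Qed.

(* For j = 5 the terms near 0 cancel exactly; the strict inequality comes from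
   an index x halfway between 0 and 5 on the long side of the cycle. *)
Lemma usum_lt_vsum5 n : 25 <= n -> usum n 0 5 < vsum n 0 5.
Proof.
(* With [m = n %/ 4] one has [n - x = 2 * m - 2]. This arc is even, so the inner distance is
   [m - 1]; the outer one is [m + 1], and the [luv] value is [m] or [m + 1]. *)
move=> hn; pose x := n.+1 %/ 2 + 2 + (n %/ 2) %% 2.
have x_bd : 10 < x < n - 3 by rewrite /x; lia.
apply: (usum_lt_vsum n 5 [:: 4; x]).
- lia.
- by rewrite /= !inE; lia.
- by rewrite /=; lia.
have [u1 v1] : uterm n 0 5 1 = 1 /\ vterm n 0 5 1 = 0 by apply: term_near.
have [u3 v3] : uterm n 0 5 3 = 1 /\ vterm n 0 5 3 = 1 by apply: term_near.
have [u4 v4] : uterm n 0 5 4 = 0 /\ vterm n 0 5 4 = 1 by apply: term_near.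
have [u1' v1'] : uterm n 0 5 (n - 1) = 1 /\ vterm n 0 5 (n - 1) = 1.
  exact: term_near_opp.
have [u3' v3'] : uterm n 0 5 (n - 3) = 1 /\ vterm n 0 5 (n - 3) = 1.
  exact: term_near_opp.
have ux : uterm n 0 5 x < vterm n 0 5 x.
  rewrite /x; apply: uterm_lt_vterm; rewrite /cyc /wrapd /luu /luv /lvv; lia.
by rewrite /= u1 v1 u3 v3 u4 v4 u1' v1' u3' v3'; lia.
Qed.

(** For [j >= 11] the four exceptional indices are so much nearer to 0 than to [j] that their terms
    cancel; this takes [luv (j - 3) > lvv 3 = 4]. One further index then decides. *)
Lemma usum_lt_vsum_odd n j : 25 <= n -> 11 <= j -> j %% 2 = 1 ->
  j.*2 <= n -> usum n 0 j < vsum n 0 j.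
Proof.
(* [x] is the even number nearest to j/2. *)
move=> hn j11 jodd jn; pose x := j.+1 %/ 4 * 2.
have x_bd : 5 < x < n - 3 by rewrite /x; lia.
apply: (usum_lt_vsum n j [:: x]).
- lia.
- by rewrite /= !inE; lia.
- by rewrite /=; lia.
have t1 : uterm n 0 j 1 <= vterm n 0 j 1.
  by apply: uterm_le_vterm_far; rewrite /cyc /wrapd /luu /luv /lvv; lia.
have t2 : uterm n 0 j 3 <= vterm n 0 j 3.
  by apply: uterm_le_vterm_far; rewrite /cyc /wrapd /luu /luv /lvv; lia.
have t3 : uterm n 0 j (n - 3) <= vterm n 0 j (n - 3).
  by apply: uterm_le_vterm_far; rewrite /cyc /wrapd /luu /luv /lvv; lia.
have t4 : uterm n 0 j (n - 1) <= vterm n 0 j (n - 1).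
  by apply: uterm_le_vterm_far; rewrite /cyc /wrapd /luu /luv /lvv; lia.
have t5 : uterm n 0 j x < vterm n 0 j x.
  rewrite /x; apply: uterm_lt_vterm; rewrite /cyc /wrapd /luu /luv /lvv; lia.
by rewrite /=; lia.
Qed.

(** * Balanced and unbalanced distances, with small n by computation *)

Definition unbalanced_at n l := has
  (fun j => (cyc luv n 0 j == l) && (usum n 0 j != vsum n 0 j)) (iota 0 n).

Lemma unbalanced_atN n l : 5 <= n -> unbalanced_at n l ->
  ~ distance_balanced (@GP n 2) l.
Proof.
move=> hn /hasP[j]; rewrite mem_iota add0n /= => jn /andP[/eqP jl /eqP uv].
move=> /(GP2_balancedP _ _ hn)[_ _ bal]; apply: uv.
have n0 : 0 < n by lia.
exact: (bal (Ordinal n0) (Ordinal jn)).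
Qed.

(** By [GP2_diameter] the ranges of [l] are 1 to D - 1 for the generic [n < 25], and 1 to D - 2 for
    9 and 11. *)
Lemma unbalanced_small :
  all (fun n => all (unbalanced_at n) (iota 1 ((n %/ 2).+1 %/ 2 + 1)))
    [:: 6, 8 & iota 12 13] &&
  all (fun n => all (unbalanced_at n) (iota 1 ((n %/ 2).+1 %/ 2))) [:: 9; 11].
Proof. by vm_compute. Qed.

Lemma unbalanced_large n l : 25 <= n -> 0 < l <= (n %/ 2).+1 %/ 2 + 1 ->
  unbalanced_at n l.
Proof.
move=> hn l_bd; have [l1|l1] := leqP l 1.
  apply/hasP; exists 0; first by rewrite mem_iota; lia.
  rewrite neq_ltn usum_lt_vsum_le9 // andbT.
  by rewrite /cyc /wrapd /luv; lia.
(* [luv (l.*2 - 3) = l], and the bound on [l] amounts to [j.*2 <= n], so the arc from 0 to [j] is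
   the shorter one. *)
apply/hasP; exists (l.*2 - 3); first by rewrite mem_iota; lia.
apply/andP; split; first by rewrite /cyc /wrapd /luv; lia.
rewrite neq_ltn; apply/orP; left; set j := l.*2 - 3.
have j_odd : j %% 2 = 1 by rewrite /j; lia.
have [j11|j11] := leqP 11 j.
  by apply: usum_lt_vsum_odd; rewrite // /j; lia.
have [->|j5] := eqVneq j 5; first exact: usum_lt_vsum5.
by apply: usum_lt_vsum_le9 => //; rewrite !inE; lia.
Qed.

(** For 5, 7 and 10 all pairs are tested whatever their distance, as the diameter formula does not
    cover 5 and 7; for 9 and 11 only pairs at distance D - 1. *)
Lemma balanced_small :
  all (fun n => all (fun i => all (fun j => usum n i j == vsum n i j)
    (iota 0 n)) (iota 0 n)) [:: 5; 7; 10] &&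
  all (fun n => all (fun i => all (fun j =>
    (cyc luv n i j == (n %/ 2).+1 %/ 2 + 1) ==> (usum n i j == vsum n i j))
    (iota 0 n)) (iota 0 n)) [:: 9; 11].
Proof. by vm_compute. Qed.

Lemma GP2_balanced_diameter n : n = 6 \/ 8 <= n ->
  distance_balanced (@GP n 2) (diameter (@GP n 2)).
Proof.
move=> hn; have n5 : 5 <= n by lia.
apply/(GP2_balancedP _ _ n5); rewrite GP2_diameter //; split=> //.
  by rewrite addn2.
(* The premise is contradictory: [luv] values stay below the diameter. *)
move=> i j; have := ltn_ord i; have := ltn_ord j.
by rewrite /cyc /wrapd /luv; lia.
Qed.

Lemma GP2_unbalanced n l : 5 <= n -> n \notin [:: 5; 7; 9; 10; 11] ->
  0 < l < diameter (@GP n 2) -> ~ distance_balanced (@GP n 2) l.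
Proof.
move=> n5; rewrite !inE => hn; rewrite GP2_diameter; last by lia.
move=> l_bd; apply: unbalanced_atN => //.
have [n25|n25] := leqP 25 n; first by apply: unbalanced_large; lia.
have /andP[/allP small _] := unbalanced_small.
have /small /allP : n \in [:: 6, 8 & iota 12 13].
  by rewrite !inE; lia.
by apply; rewrite mem_iota; lia.
Qed.

Lemma GP2_balanced_5_7_10 n l : n \in [:: 5; 7; 10] ->
  0 < l <= diameter (@GP n 2) -> distance_balanced (@GP n 2) l.
Proof.
move=> hn /andP[l0 lD].
have /andP[/allP/(_ n hn)/allP small _] := balanced_small.
have n5 : 5 <= n by move: hn; rewrite !inE; lia.
apply/(GP2_balancedP _ _ n5); split=> // i j _.
have /allP/(_ j) : all (fun k => usum n i k == vsum n i k) (iota 0 n).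
  by apply: small; rewrite mem_iota add0n /=.
by rewrite mem_iota add0n /= ltn_ord => /(_ isT)/eqP.
Qed.

Lemma GP2_balanced_9_11 n : n \in [:: 9; 11] ->
  distance_balanced (@GP n 2) (diameter (@GP n 2) - 1).
Proof.
move=> hn; have /andP[_ /allP/(_ n hn)/allP small] := balanced_small.
have n8 : 8 <= n by move: hn; rewrite !inE; lia.
have n5 : 5 <= n by lia.
apply/(GP2_balancedP _ _ n5); rewrite GP2_diameter; last by right.
split; [lia|lia|move=> i j ij].
have /small/allP/(_ j) : (i : nat) \in iota 0 n by rewrite mem_iota add0n /=.
rewrite mem_iota add0n /= ltn_ord => /(_ isT)/implyP/[!ij] H.
by apply/eqP/H; lia.
Qed.

Lemma GP2_unbalanced_9_11 n l : n \in [:: 9; 11] ->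
  0 < l <= diameter (@GP n 2) - 2 -> ~ distance_balanced (@GP n 2) l.
Proof.
move=> hn; have /andP[_ /allP/(_ n hn)/allP small] := unbalanced_small.
have n8 : 8 <= n by move: hn; rewrite !inE; lia.
rewrite GP2_diameter; last by right.
move=> l_bd; apply: unbalanced_atN; first by lia.
by apply: small; rewrite mem_iota; lia.
Qed.

(** * Classification *)

Lemma GP2_diameter_ge2 n : 5 <= n -> 2 <= diameter (@GP n 2).
Proof.
move=> hn; have n0 : 0 < n by lia.
have n1 : 1 < n by lia.
apply: leq_trans (GP2_dist_le_diameter n (inl (Ordinal n0))
  (inr (Ordinal n1)) hn).
by rewrite /= /cyc /wrapd /luv; lia.
Qed.

(* In the second item the range 1 <= l <= D - 2 is required to be nonempty:    *)
(* for n = 5 one has D = 2 and the Petersen graph would satisfy it vacuously.  *)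
Theorem theorem4p7 (n : nat) (hn : 5 <= n) :
  let D := diameter (@GP n 2) in
  [/\ highly_distance_balanced (@GP n 2) <-> n \in [:: 5; 7; 10],
      [/\ distance_balanced (@GP n 2) D,
          distance_balanced (@GP n 2) (D - 1),
          1 <= D - 2 &
          forall l, 1 <= l <= D - 2 -> ~ distance_balanced (@GP n 2) l]
        <-> n \in [:: 9; 11],
      distance_balanced (@GP n 2) D /\
        (forall l, 1 <= l <= D - 1 -> ~ distance_balanced (@GP n 2) l)
        <-> n \notin [:: 5; 7; 9; 10; 11] &
      11 < n ->
        distance_balanced (@GP n 2) D /\
        (forall l, 1 <= l <= D - 1 -> ~ distance_balanced (@GP n 2) l)].
Proof.
move=> D; have D2 : 2 <= D by apply: GP2_diameter_ge2.
have l1 : 1 <= 1 <= D - 1 by lia.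
have cases : [|| n \in [:: 5; 7; 10], n \in [:: 9; 11]
               | n \notin [:: 5; 7; 9; 10; 11]] by rewrite !inE; lia.
have generic : n \notin [:: 5; 7; 9; 10; 11] -> distance_balanced (@GP n 2) D /\
    (forall l, 1 <= l <= D - 1 -> ~ distance_balanced (@GP n 2) l).
  move=> hN; split; last by move=> l lD; apply: GP2_unbalanced; lia.
  by apply: GP2_balanced_diameter; move: hN; rewrite !inE; lia.
have two : n \in [:: 9; 11] -> [/\ distance_balanced (@GP n 2) D,
    distance_balanced (@GP n 2) (D - 1), 1 <= D - 2 &
    forall l, 1 <= l <= D - 2 -> ~ distance_balanced (@GP n 2) l].
  move=> h2; have n8 : 8 <= n by move: h2; rewrite !inE; lia.
  split; first by apply: GP2_balanced_diameter; right.
  - exact: GP2_balanced_9_11.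
  - by rewrite /D GP2_diameter; lia.
  by move=> l; apply: GP2_unbalanced_9_11.
have high : n \in [:: 5; 7; 10] -> highly_distance_balanced (@GP n 2).
  move=> h3; split; first exact: GP2_connected.
  by move=> l; apply: GP2_balanced_5_7_10.
(* The three classes exclude each other: [l = 1] separates the first from the other two, [l = D - 1]
   the second from the third. *)
split.
- split=> // -[_ bal]; case/or3P: cases => // hn'.
    have [_ _ D3 unbal] := two hn'.
    by case: (unbal 1); [lia | apply: bal; lia].
  have [_ unbal] := generic hn'.
  by case: (unbal 1); [lia | apply: bal; lia].
- split=> // -[_ balD D3 unbal]; case/or3P: cases => // hn'.
    have [_ bal] := high hn'.
    by case: (unbal 1); [lia | apply: bal; rewrite -/D; lia].
  have [_ unbal'] := generic hn'.
  by case: (unbal' (D - 1)); [lia|].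
- split=> // -[_ unbal]; case/or3P: cases => // hn'.
    have [_ bal] := high hn'.
    by case: (unbal 1); [lia | apply: bal; rewrite -/D; lia].
  have [_ balD D3 _] := two hn'.
  by case: (unbal (D - 1)); [lia|].
by move=> n11; apply: generic; rewrite !inE; lia.
Qed.
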